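(* Let $n\ge 2$, $1<k\le n$, and let $a\in\mathbb{R}^{n+1}$ with $|a|>1$. If $f\in C(\mathbb{S}^n)$, then for every $\tau\in\mathcal{T}_a(n+1,k)$, $$(F_a f)(\tau)=(\Pi_a M_{a^*}f)(\varphi_{a^*}\tau).$$
   Context: $\mathbb{S}^n$ is the unit sphere and $\mathbb{B}^{n+1}$ the open unit ball in $\mathbb{R}^{n+1}$; $x\cdot y$ is the dot product. $\mathcal{T}_a(n+1,k)$ is the set of all $k$-dimensional affine planes in $\mathbb{R}^{n+1}$ that pass through the point $a$ and meet $\mathbb{B}^{n+1}$; $\mathcal{Z}_a(n+1,k)$ is the set of all $k$-dimensional affine planes in $\mathbb{R}^{n+1}$ that are parallel to the vector $a$ and meet $\mathbb{B}^{n+1}$. For continuous $f$ on $\mathbb{S}^n$, $$(F_a f)(\tau)=\int_{\mathbb{S}^n\cap\tau}f(x)\,d\sigma(x)\quad(\tau\in\mathcal{T}_a(n+1,k)),\qquad (\Pi_a f)(\zeta)=\int_{\mathbb{S}^n\cap\zeta}f(x)\,d\sigma(x)\quad(\zeta\in\mathcal{Z}_a(n+1,k)),$$ where $d\sigma$ is the $(k-1)$-dimensional surface area measure on the subsphere. Put $a^*=a/|a|^2$ (so $|a^*|<1$), $s_{a^*}=\sqrt{1-|a^*|^2}$, $\mathrm{P}_{a^*}x=\frac{a^*\cdot x}{|a^*|^2}a^*$, $\mathrm{Q}_{a^*}x=x-\mathrm{P}_{a^*}x$, and $$\varphi_{a^*}x=\frac{a^*-\mathrm{P}_{a^*}x-s_{a^*}\mathrm{Q}_{a^*}x}{1-x\cdot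 a^*},\qquad x\cdot a^*\ne 1.$$ This is an involution which maps $\mathbb{S}^n$ onto itself and $\mathbb{B}^{n+1}$ onto itself. With $H=\{x: x\cdot a^*=1\}$, for $\tau\in\mathcal{T}_a(n+1,k)$ the notation $\varphi_{a^*}\tau$ means the plane $\zeta\in\mathcal{Z}_a(n+1,k)$ such that $\varphi_{a^*}(\tau\setminus H)=\zeta\setminus H$; in particular $\mathbb{S}^n\cap\zeta=\varphi_{a^*}(\mathbb{S}^n\cap\tau)$. For $y\in\mathbb{S}^n$, $$(M_{a^*}f)(y)=\left(\frac{s_{a^*}}{1-a^*\cdot y}\right)^{k-1}f(\varphi_{a^*}y).$$ *)

(* Defs.v *)
From HB Require Import structures.
From mathcomp Require Import all_boot all_order all_algebra.
From mathcomp Require Import all_classical all_reals all_analysis.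

Set Implicit Arguments.
Unset Strict Implicit.
Unset Printing Implicit Defensive.

Import Order.TTheory GRing.Theory Num.Theory.
Import numFieldNormedType.Exports.

Local Open Scope classical_set_scope.
Local Open Scope ring_scope.

(* The library's norm `|x| on row vectors is the maximum norm (it induces the
   same topology), so the Euclidean structure is introduced separately. *)
Definition dotp (R : realType) (N : nat) (x y : 'rV[R]_N) : R :=
  \sum_i x 0 i * y 0 i.

Definition enorm (R : realType) (N : nat) (x : 'rV[R]_N) : R :=
  Num.sqrt (dotp x x).

Definition usphere {R : realType} {n : nat} : set 'rV[R]_n.+1 :=
  [set x | enorm x = 1].

Definition uball {R : realType} {n : nat} : set 'rV[R]_n.+1 :=
  [set x | enorm x < 1].

(* d-dimensional Hausdorff measure of R^N for the Euclidean distance,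
   normalised by the volume of the unit ball of R^d; on a d-dimensional sphere
   it is the surface area measure. *)
Section Hausdorff.
Context {R : realType} {N : nat}.
Implicit Types (A C : set 'rV[R]_N) (d : nat).
Local Open Scope ereal_scope.

(* ediam set0 = -oo *)
Definition ediam C : \bar R :=
  ereal_sup [set (enorm (x - y))%:E | x in C & y in C].

(* V_0 = 1, V_1 = 2, V_(m+2) = 2 pi / (m+2) * V_m, that is
   V_d = pi^(d/2) / Gamma (d/2 + 1) *)
Fixpoint unit_ball_volume (d : nat) : R :=
  match d with
  | 0 => 1
  | 1 => 2
  | (m.+1 as m').+1 => (2 * pi / m'.+1%:R * unit_ball_volume m)%R
  end.

Definition hausdorff_gauge d C : \bar R :=
  if C == set0 then 0
  else (unit_ball_volume d)%:E * ((2^-1)%:E * ediam C) ^+ d.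

Definition delta_cover (delta : R) A : set ((set 'rV[R]_N)^nat) :=
  [set C | A `<=` \bigcup_i C i /\ forall i, ediam (C i) <= delta%:E].

Definition hausdorff_delta d (delta : R) A : \bar R :=
  ereal_inf [set \sum_(i <oo) hausdorff_gauge d (C i)
            | C in delta_cover delta A].

Definition hausdorff d A : \bar R :=
  ereal_sup [set hausdorff_delta d delta A | delta in [set e | (0 < e)%R]].

Lemma unit_ball_volume_ge0 d : (0 <= unit_ball_volume d)%R.
Proof.
suff : (0 <= unit_ball_volume d)%R /\ (0 <= unit_ball_volume d.+1)%R by case.
elim: d => [|d [IH1 IH2]]; first by split=> //=.
split=> //=; rewrite mulr_ge0// divr_ge0// mulr_ge0//.
exact: pi_ge0.
Qed.

Lemma hausdorff_gauge_ge0 d C : 0 <= hausdorff_gauge d C.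
Proof.
rewrite /hausdorff_gauge; case: eqP => // /eqP/set0P[x Cx].
rewrite mule_ge0 ?lee_fin ?unit_ball_volume_ge0// expe_ge0// mule_ge0//.
apply: le_trans (ereal_sup_ubound _ : (enorm (x - x))%:E <= _).
  by rewrite lee_fin sqrtr_ge0.
by exists x => //; exists x.
Qed.

Lemma hausdorff_delta_ge0 d delta A : 0 <= hausdorff_delta d delta A.
Proof.
apply: le_ereal_inf_tmp => _ [C _ <-].
by apply: nneseries_ge0 => *; exact: hausdorff_gauge_ge0.
Qed.

Lemma hausdorff_delta0 d delta : hausdorff_delta d delta set0 = 0.
Proof.
apply/eqP; rewrite eq_le hausdorff_delta_ge0 andbT.
apply: ereal_inf_lbound; exists (fun=> set0).
  split=> // _; rewrite /ediam (_ : [set _ | _ in _ & _ in _] = set0).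
    by rewrite ereal_sup0 leNye.
  by apply/seteqP; split=> // ? [].
by apply: eseries0 => i _ _; rewrite /hausdorff_gauge eqxx.
Qed.

Lemma le_hausdorff_delta d delta :
  {homo hausdorff_delta d delta : A B / A `<=` B >-> A <= B}.
Proof.
move=> A B AB; apply/ereal_inf_le_tmp => _ [C [BC Cd] <-].
by exists C => //; split=> //; exact: subset_trans BC.
Qed.

Lemma hausdorff_delta_sigma_subadditive d delta :
  sigma_subadditive (hausdorff_delta d delta).
Proof.
set mu := hausdorff_delta d delta; set g := hausdorff_gauge d.
have g0 : forall C, 0 <= g C by exact: hausdorff_gauge_ge0.
have mu0 : forall A, 0 <= mu A by exact: hausdorff_delta_ge0.
move=> A; have [[i ioo]|] := pselect (exists i, mu (A i) = +oo).
  rewrite (eseries_pinfty _ _ ioo) ?leey// => n _.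
  by rewrite -ltNye (lt_le_trans _ (mu0 _)).
rewrite -forallNE => Aoo.
suff add2e (e : {posnum R}) :
    mu (\bigcup_n A n) <= \sum_(i <oo) mu (A i) + e%:num%:E.
  by apply/lee_addgt0Pr => _/posnumP[].
rewrite (le_trans _ (epsilon_trick _ _ _))//.
pose P n (B : (set 'rV[R]_N)^nat) := delta_cover delta (A n) B /\
  \sum_(k <oo) g (B k) <= mu (A n) + (e%:num / (2 ^ n.+1)%:R)%:E.
have [G PG] : {G : ((set 'rV[R]_N)^nat)^nat & forall n, P n (G n)}.
  apply: (@choice _ _ P) => n; rewrite /P /mu /hausdorff_delta.
  set S := (X in ereal_inf X); move infS : (ereal_inf S) => iS.
  case: iS infS => [r Sr|Soo|Soo].
  - have en1 : (0 < e%:num / (2 ^ n.+1)%:R)%R by [].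
    have /(lb_ereal_inf_adherent en1) : ereal_inf S \is a fin_num by rewrite Sr.
    move=> [x [B AnB muBx] xS].
    by exists B; split => //; rewrite muBx -Sr; exact/ltW.
  - by have := Aoo n; rewrite /mu /hausdorff_delta Soo.
  - suff : lbound S 0 by move/le_ereal_inf_tmp; rewrite Soo.
    by move=> /= _ [B _ <-]; exact: nneseries_ge0.
have gG_ge0 x : 0 <= (g \o uncurry G) x by exact: g0.
apply: (@le_trans _ _ (\esum_(i in setT) (g \o uncurry G) i)).
  apply: ereal_inf_lbound => /=.
  have /card_esym/ppcard_eqP[f] := card_nat2.
  exists (uncurry G \o f).
    split => [t [i _ Ait]|i]; last first.
      by rewrite /=; case: (f i) => p q; exact: (PG p).1.2.
    have [j _ Bijt] := (PG i).1.1 _ Ait.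
    by exists (f^-1%FUN (i, j)) => //=; rewrite invK ?inE.
  rewrite -(esum_pred_image (g \o uncurry G) _ xpredT) ?[fun=> _]set_true//.
  by rewrite image_eq.
rewrite (_ : esum _ _ = \sum_(i <oo) \sum_(j <oo) g (G i j)); last first.
  pose J : nat -> set (nat * nat) := fun i => [set (i, j) | j in setT].
  rewrite (_ : setT = \bigcup_k J k); last first.
    by rewrite predeqE => -[a b]; split => // _; exists a => //; exists b.
  rewrite esum_bigcupT //=; last first.
    apply/trivIsetP => i j _ _ ij.
    rewrite predeqE => -[n m] /=; split => //= -[] [_] _ [<-{n} _].
    by move=> [m' _] [] /esym/eqP; rewrite (negbTE ij).
  rewrite -(image_id [set: nat]) -fun_true esum_pred_image//; last first.
    by move=> n _; exact: esum_ge0.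
  apply: eq_eseriesr => /= j _.
  rewrite -(esum_pred_image (g \o uncurry G) (pair j) predT)//=; last first.
    by move=> ? ? _ _; exact: (@can_inj _ _ _ snd).
  by congr esum; rewrite predeqE => -[a b]; split; move=> [i _ <-]; exists i.
apply: lee_nneseries => [i _ _|i _]; last exact: (PG i).2.
by apply: nneseries_ge0 => *; exact: g0.
Qed.

Lemma hausdorff0 d : hausdorff d set0 = 0.
Proof.
rewrite /hausdorff (_ : [set _ | _ in _] = [set 0]) ?ereal_sup1//.
apply/seteqP; split=> [_ [delta _ <-]|_ ->] /=; first exact: hausdorff_delta0.
by exists 1%R; [rewrite /= ltr01|exact: hausdorff_delta0].
Qed.

Lemma hausdorff_ge0 d A : 0 <= hausdorff d A.
Proof.
apply: le_trans (hausdorff_delta_ge0 d 1 A) _.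
by apply: ereal_sup_ubound; exists 1%R => //=; rewrite ltr01.
Qed.

Lemma le_hausdorff d : {homo hausdorff d : A B / A `<=` B >-> A <= B}.
Proof.
move=> A B AB; apply: ge_ereal_sup => _ [delta delta0 <-].
apply: le_trans (le_hausdorff_delta d delta AB) _.
by apply: ereal_sup_ubound; exists delta.
Qed.

Lemma hausdorff_sigma_subadditive d : sigma_subadditive (hausdorff d).
Proof.
move=> A; apply: ge_ereal_sup => _ [delta delta0 <-].
apply: le_trans (hausdorff_delta_sigma_subadditive d delta A) _.
apply: lee_nneseries => [i _ _|i _]; first exact: hausdorff_delta_ge0.
by apply: ereal_sup_ubound; exists delta.
Qed.

HB.instance Definition _ d := isOuterMeasure.Build R 'rV[R]_N (hausdorff d)
  (hausdorff0 d) (hausdorff_ge0 d) (@le_hausdorff d)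
  (@hausdorff_sigma_subadditive d).

Definition hausdorff_outer d : {outer_measure set 'rV[R]_N -> \bar R} :=
  hausdorff d.

(* Caratheodory's theorem makes this outer measure a measure on its
   Caratheodory-measurable sets (among them the Borel sets). *)
Definition hausdorff_measure d :
    {measure set (caratheodory_type (hausdorff_outer d)) -> \bar R} :=
  OuterMeasure.sort (hausdorff_outer d).

End Hausdorff.

Section Transforms.
Context {R : realType} {n : nat}.
Implicit Types (a b x y : 'rV[R]_n.+1) (f : 'rV[R]_n.+1 -> R)
  (k : nat) (t z : set 'rV[R]_n.+1).

Definition affine_plane (p : 'rV[R]_n.+1) (V : {vspace 'rV[R]_n.+1}) :
  set 'rV[R]_n.+1 := [set x | x - p \in V].

(* T_a(n+1,k) *)
Definition planes_through k a : set (set 'rV[R]_n.+1) :=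
  [set t | (exists (p : 'rV[R]_n.+1) (V : {vspace 'rV[R]_n.+1}),
              \dim V = k /\ t = affine_plane p V) /\
           t a /\ t `&` uball !=set0].

(* Z_a(n+1,k) *)
Definition planes_parallel k a : set (set 'rV[R]_n.+1) :=
  [set z | (exists (p : 'rV[R]_n.+1) (V : {vspace 'rV[R]_n.+1}),
              \dim V = k /\ z = affine_plane p V /\ a \in V) /\
           z `&` uball !=set0].

Definition section_integral k f t : \bar R :=
  (\int[hausdorff_measure k.-1]_(x in usphere `&` t) (f x)%:E)%E.

(* F_a and Pi_a are given by the same integral; they differ in the family of
   planes they are applied to, planes_through k a and planes_parallel k a. *)
Definition Ftransform k f t : \bar R := section_integral k f t.
Definition Pitransform k f z : \bar R := section_integral k f z.

Definition star a := (enorm a ^+ 2)^-1 *: a.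

Definition scoef b : R := Num.sqrt (1 - enorm b ^+ 2).

Definition Pproj b x := (dotp b x / enorm b ^+ 2) *: b.

Definition Qproj b x := x - Pproj b x.

Definition phi b x :=
  (1 - dotp x b)^-1 *: (b - Pproj b x - scoef b *: Qproj b x).

Definition hyperplane b : set 'rV[R]_n.+1 := [set x | dotp x b = 1].

(* phi_{a*} t: the plane z in Z_a(n+1,k) with phi(t \ H) = z \ H (set0 if
   there were none). *)
Definition phi_plane k a t : set 'rV[R]_n.+1 :=
  xget set0 [set z | planes_parallel k a z /\
    phi (star a) @` (t `\` hyperplane (star a)) =
      z `\` hyperplane (star a)].

Definition Mtransform k b f y : R :=
  (scoef b / (1 - dotp b y)) ^+ k.-1 * f (phi b y).

End Transforms.

(* Main.v *)
(* For x, y on the sphere, phi_b satisfies exactly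
     |phi_b x - phi_b y|^2 = lam(x) lam(y) |x - y|^2,  lam(y) = s_b / (1 - b.y),
   so on a slab {lam <= v} it is v-Lipschitz for all pairs of points, and it
   increases d-dimensional Hausdorff measure there by a factor at most v^d.
   Cutting the sphere into finitely many slabs u <= lam < rho u and letting rho
   tend to 1 gives int_{phi B} f <= int_B lam^d (f o phi) for every Borel f >= 0;
   the same inequality for lam^d (f o phi) is the converse, since phi is an
   involution and lam(phi y) lam(y) = 1. *)

(* No area formula is involved: the measure is defined by covers, and a Lipschitz map controls it
   from above only. This is why the equality is assembled from two inequalities between nonnegative
   integrals with values in [0, +oo]. The second constraint is measurability. Stability of the
   Caratheodory sigma-algebra of [hausdorff] under preimages by phi is not evident, whereas for
   Borel sets it follows from the continuity of phi on the sphere. So closed sets are shown to be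
   Caratheodory-measurable, sections of the sphere to be Borel, and integrals are moved to the Borel
   sigma-algebra. Of the plane phi(t), only the trace on the sphere enters the integral; since |a*|
   < 1, the hyperplane H misses the sphere, and this trace is the image by phi of the trace of t. *)
From HB Require Import structures.
Require Import Defs.
From mathcomp Require Import all_boot all_order all_algebra.
From mathcomp Require Import all_classical all_reals all_analysis.
From mathcomp Require Import measurable_realfun ring lra.
Set Implicit Arguments.
Unset Strict Implicit.
Unset Printing Implicit Defensive.

Import Order.TTheory GRing.Theory Num.Theory.
Import numFieldNormedType.Exports.
Local Open Scope classical_set_scope.
Local Open Scope ring_scope.

(** * Euclidean structure *)

Section Euclid.
Context {R : realType} {N : nat}.
Implicit Types x y z : 'rV[R]_N.

Lemma dotpC x y : dotp x y = dotp y x.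
Proof. by apply: eq_bigr => i _; rewrite mulrC. Qed.

Lemma dotpDl x y z : dotp (x + y) z = dotp x z + dotp y z.
Proof. by rewrite /dotp -big_split; apply: eq_bigr => i _ /=; rewrite mxE mulrDl. Qed.

Lemma dotpZl (c : R) x z : dotp (c *: x) z = c * dotp x z.
Proof. by rewrite /dotp mulr_sumr; apply: eq_bigr => i _ /=; rewrite mxE mulrA. Qed.

Lemma dotpBl x y z : dotp (x - y) z = dotp x z - dotp y z.
Proof. by rewrite dotpDl -scaleN1r dotpZl mulN1r. Qed.

Lemma dotpDr z x y : dotp z (x + y) = dotp z x + dotp z y.
Proof. by rewrite dotpC dotpDl !(dotpC z). Qed.

Lemma dotpZr (c : R) z x : dotp z (c *: x) = c * dotp z x.
Proof. by rewrite dotpC dotpZl (dotpC z). Qed.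

Lemma dotpBr z x y : dotp z (x - y) = dotp z x - dotp z y.
Proof. by rewrite dotpC dotpBl !(dotpC z). Qed.

Lemma dotp_ge0 x : 0 <= dotp x x.
Proof. by apply: sumr_ge0 => i _; rewrite -expr2 sqr_ge0. Qed.

Lemma enorm_ge0 x : 0 <= enorm x.
Proof. exact: sqrtr_ge0. Qed.

Lemma sqr_enorm x : enorm x ^+ 2 = dotp x x.
Proof. by rewrite sqr_sqrtr// dotp_ge0. Qed.

Lemma ler_coord_enorm x i : `|x 0 i| <= enorm x.
Proof.
rewrite -(@ler_pXn2r _ 2) ?nnegrE ?enorm_ge0// sqr_enorm real_normK ?num_real//.
rewrite /dotp (bigD1 i)//= -expr2 lerDl.
by apply: sumr_ge0 => j _; rewrite -expr2 sqr_ge0.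
Qed.

Lemma dotp_eq0 x : (dotp x x == 0) = (x == 0).
Proof.
apply/idP/eqP => [/eqP x0|->]; last first.
  by rewrite /dotp big1// => i _; rewrite mxE mul0r.
apply/matrixP => i j; rewrite !mxE ord1; apply/eqP.
rewrite -normr_eq0 eq_le normr_ge0 andbT.
by rewrite (le_trans (ler_coord_enorm x j))// /enorm x0 sqrtr0.
Qed.

Lemma sqr_dotp_le x y : dotp x y ^+ 2 <= dotp x x * dotp y y.
Proof.
have [/eqP|y0] := eqVneq (dotp y y) 0.
  rewrite dotp_eq0 => /eqP ->; rewrite dotpC -(scale0r x) !dotpZl !mul0r.
  by rewrite mulr0 expr0n.
have y1 : 0 < dotp y y by rewrite lt_neqAle eq_sym y0 dotp_ge0.
rewrite -subr_ge0 -(pmulr_rge0 _ y1).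
(* The square of this vector is [dotp y y] times the Cauchy-Schwarz defect. *)
have := dotp_ge0 (dotp y y *: x - dotp x y *: y).
rewrite !(dotpBl, dotpBr, dotpZl, dotpZr) (dotpC y x).
by congr (0 <= _); ring.
Qed.

Lemma dotp_le_enorm x y : dotp x y <= enorm x * enorm y.
Proof.
apply: le_trans (ler_norm _) _.
rewrite -(@ler_pXn2r _ 2) ?nnegrE ?mulr_ge0 ?enorm_ge0//.
by rewrite exprMn !sqr_enorm real_normK ?num_real// sqr_dotp_le.
Qed.

Lemma enormD x y : enorm (x + y) <= enorm x + enorm y.
Proof.
rewrite -(@ler_pXn2r _ 2) ?nnegrE ?addr_ge0 ?enorm_ge0//.
rewrite sqr_enorm dotpDl !dotpDr (dotpC y x) sqrrD !sqr_enorm.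
by have := dotp_le_enorm x y; lra.
Qed.

Lemma enormN x : enorm (- x) = enorm x.
Proof. by rewrite /enorm -scaleN1r dotpZl dotpZr !mulN1r opprK. Qed.

Lemma continuous_dotp y : continuous (fun x : 'rV[R]_N => dotp x y).
Proof.
apply: (continuous_big add_continuous) => i _ x.
apply: (@continuousM _ _ (fun x : 'rV[R]_N => x 0 i)).
  exact: coord_continuous.
exact: cst_continuous.
Qed.

Lemma continuous_dotp_self : continuous (fun x : 'rV[R]_N => dotp x x).
Proof.
apply: (continuous_big add_continuous) => i _ x.
by apply: (@continuousM _ _ (fun x : 'rV[R]_N => x 0 i)); exact: coord_continuous.
Qed.

End Euclid.

(** * Hausdorff measure *)

Section HausdorffTheory.
Context {R : realType} {N : nat}.
Implicit Types (A B C : set 'rV[R]_N) (d : nat).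
Local Open Scope ereal_scope.

Lemma hausdorff_gauge0 d : hausdorff_gauge d (@set0 'rV[R]_N) = 0.
Proof. by rewrite /hausdorff_gauge eqxx. Qed.

Lemma ediam_set0 : ediam (@set0 'rV[R]_N) = -oo.
Proof.
rewrite /ediam (_ : [set _ | _ in _ & _ in _] = set0) ?ereal_sup0//.
by apply/seteqP; split=> // ? [].
Qed.

Lemma ediam_ge0 C : C !=set0 -> 0 <= ediam C.
Proof.
move=> [x Cx]; apply: le_trans (ereal_sup_ubound _ : (enorm (x - x))%:E <= _).
  by rewrite lee_fin enorm_ge0.
by exists x => //; exists x.
Qed.

Lemma le_ediam : {homo @ediam R N : A B / A `<=` B >-> A <= B}.
Proof.
move=> A B AB; apply: ereal_sup_le => _ [x Ax [y Ay <-]].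
by exists x; [exact: AB|exists y => //; exact: AB].
Qed.

Lemma ediam_image_le (g : 'rV[R]_N -> 'rV[R]_N) (v : R) C : (0 <= v)%R ->
  (forall x y, C x -> C y -> enorm (g x - g y) <= v * enorm (x - y))%R ->
  C !=set0 -> ediam (g @` C) <= v%:E * ediam C.
Proof.
move=> v0 gv C0; apply: ge_ereal_sup => _ [_ [x Cx <-] [_ [y Cy <-] <-]].
apply: (@le_trans _ _ (v%:E * (enorm (x - y))%:E)); first by rewrite -EFinM lee_fin gv.
apply: lee_wpmul2l; first by rewrite lee_fin.
by apply: ereal_sup_ubound; exists x => //; exists y.
Qed.

Lemma hausdorff_delta_le d (e : R) A : (0 < e)%R ->
  hausdorff_delta d e A <= hausdorff d A.
Proof. by move=> e0; apply: ereal_sup_ubound; exists e. Qed.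


Lemma lee_expe (x y : \bar R) n : 0 <= x -> x <= y -> x ^+ n <= y ^+ n.
Proof.
by move=> x0 xy; elim: n => [//|n IH]; rewrite !expeS lee_pmul// expe_ge0.
Qed.

Lemma expeMn (v : R) (y : \bar R) n : (v%:E * y) ^+ n = (v ^+ n)%:E * y ^+ n.
Proof.
elim: n => [|n IH]; first by rewrite !expe0 mule1.
by rewrite !expeS exprS EFinM IH muleACA.
Qed.

Lemma hausdorff_gauge_image_le d (g : 'rV[R]_N -> 'rV[R]_N) (v : R) C :
  (0 <= v)%R ->
  (forall x y, C x -> C y -> enorm (g x - g y) <= v * enorm (x - y))%R ->
  hausdorff_gauge d (g @` C) <= (v ^+ d)%:E * hausdorff_gauge d C.
Proof.
move=> v0 gv; have [->|/set0P C0] := eqVneq C set0.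
  by rewrite image_set0 hausdorff_gauge0 mule0.
have gC0 : g @` C !=set0 by case: C0 => x Cx; exists (g x), x.
rewrite /hausdorff_gauge; move/set0P: (C0) => /negbTE ->.
move/set0P: (gC0) => /negbTE ->.
rewrite muleCA; apply: lee_wpmul2l; first by rewrite lee_fin unit_ball_volume_ge0.
rewrite -expeMn; apply: lee_expe; first by rewrite mule_ge0// ediam_ge0.
rewrite muleCA; apply: lee_wpmul2l; first by rewrite lee_fin.
exact: ediam_image_le.
Qed.

Lemma hausdorff_lipschitz d (g : 'rV[R]_N -> 'rV[R]_N) (v : R) B :
  (0 < v)%R ->
  (forall x y, B x -> B y -> enorm (g x - g y) <= v * enorm (x - y))%R ->
  hausdorff d (g @` B) <= (v ^+ d)%:E * hausdorff d B.
Proof.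
move=> v0 gv; have vd0 : (0 < v ^+ d)%R by rewrite exprn_gt0.
apply: ge_ereal_sup => _ [e /= e0 <-].
apply: (@le_trans _ _ ((v ^+ d)%:E * hausdorff_delta d (e / v) B)); last first.
  apply: lee_wpmul2l; first by rewrite lee_fin ltW.
  by apply: hausdorff_delta_le; rewrite divr_gt0.
rewrite -lee_pdivrMl//; apply: le_ereal_inf_tmp => _ [C [BC Cd] <-].
rewrite lee_pdivrMl// -nneseriesZl; last by move=> *; exact: hausdorff_gauge_ge0.
apply: (@le_trans _ _ (\sum_(i <oo) hausdorff_gauge d (g @` (C i `&` B)))).
  apply: ereal_inf_lbound; exists (fun i => g @` (C i `&` B)) => //; split.
    by move=> _ [x Bx <-]; have [i _ Cix] := BC _ Bx; exists i => //; exists x.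
  move=> i; have [->|/set0P CB0] := eqVneq (C i `&` B) set0.
    by rewrite image_set0 ediam_set0 leNye.
  apply: (le_trans (ediam_image_le (g := g) (ltW v0) _ CB0)).
    by move=> x y [_ Bx] [_ By]; exact: gv.
  rewrite -lee_pdivlMl// -EFinM mulrC; apply: le_trans (Cd i).
  by apply: le_ediam; exact: subIsetl.
apply: lee_nneseries => [i _ _|i _]; first exact: hausdorff_gauge_ge0.
apply: (le_trans (hausdorff_gauge_image_le d (g := g) (ltW v0) _)).
  by move=> x y [_ Bx] [_ By]; exact: gv.
apply: lee_wpmul2l; first by rewrite lee_fin ltW.
(* The empty set is set apart: its [ediam] is -oo, and powers are monotone only from 0 on. *)
rewrite /hausdorff_gauge; have [_|CB0] := eqVneq (C i `&` B) set0.
  exact: hausdorff_gauge_ge0.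
have /negbTE -> : C i != set0 by apply: contraNneq CB0 => ->; rewrite set0I.
apply: lee_wpmul2l; first by rewrite lee_fin unit_ball_volume_ge0.
apply: lee_expe; first by rewrite mule_ge0// ediam_ge0//; exact/set0P.
by apply: lee_wpmul2l; [rewrite lee_fin|apply: le_ediam; exact: subIsetl].
Qed.

(** A piece of diameter at most [delta] cannot meet both [A] and [B], so a cover of the union
    contains a cover of each, and no piece serves twice. *)
Lemma hausdorff_delta_separated d (delta e : R) A B : (delta < e)%R ->
  (forall x y, A x -> B y -> e <= enorm (x - y))%R ->
  hausdorff_delta d delta A + hausdorff_delta d delta B <=
  hausdorff_delta d delta (A `|` B).
Proof.
move=> de sep; apply: le_ereal_inf_tmp => _ [C [ABC Cd] <-].
pose T D i := if C i `&` D == set0 then set0 else C i.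
have cT D : D `<=` A `|` B -> delta_cover delta D (T D).
  move=> DAB; split=> [x Dx|i].
    have [i _ Cix] := ABC _ (DAB _ Dx); exists i => //; rewrite /T.
    by case: eqP => // CD; suff : set0 x by []; rewrite -CD.
  by rewrite /T; case: ifPn => // _; rewrite ediam_set0 leNye.
have hT D : D `<=` A `|` B ->
    hausdorff_delta d delta D <= \sum_(i <oo) hausdorff_gauge d (T D i).
  by move=> DAB; apply: ereal_inf_lbound; exists (T D) => //; exact: cT.
apply: le_trans (leeD (hT A _) (hT B _)) _; [exact: subsetUl|exact: subsetUr|].
rewrite -nneseriesD; try by move=> *; exact: hausdorff_gauge_ge0.
apply: lee_nneseries => [i _ _|i _].
  by rewrite adde_ge0// hausdorff_gauge_ge0.
rewrite /T; have [_|/set0P[x [Cx Ax]]] := eqVneq (C i `&` A) set0.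
  rewrite hausdorff_gauge0 add0e; case: ifPn => // _.
  by rewrite hausdorff_gauge0 hausdorff_gauge_ge0.
have [_|/set0P[y [Cy By]]] := eqVneq (C i `&` B) set0.
  by rewrite hausdorff_gauge0 adde0.
have : (enorm (x - y))%:E <= delta%:E.
  apply: le_trans (Cd i); apply: ereal_sup_ubound.
  by exists x => //; exists y.
by rewrite lee_fin => /(le_trans (sep _ _ Ax By)); rewrite leNgt de.
Qed.

(** The two suprema are approached at independent scales [e1] and [e2], then compared at the finer
    common scale [m < e]. Terms are moved across by subtraction, hence the separate treatment of an
    infinite right-hand side. *)
Lemma hausdorff_separated d (e : R) A B : (0 < e)%R ->
  (forall x y, A x -> B y -> e <= enorm (x - y))%R ->
  hausdorff d A + hausdorff d B <= hausdorff d (A `|` B).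
Proof.
move=> e0 sep; have [->|ABoo] := eqVneq (hausdorff d (A `|` B)) +oo.
  by rewrite leey.
have ABfin : hausdorff d (A `|` B) \is a fin_num.
  by rewrite ge0_fin_numE ?hausdorff_ge0// ltey.
have fin D : D `<=` A `|` B -> hausdorff d D \is a fin_num.
  move=> DAB; rewrite ge0_fin_numE ?hausdorff_ge0//.
  by rewrite (le_lt_trans (le_hausdorff d DAB))// -ge0_fin_numE ?hausdorff_ge0.
have Bfin : hausdorff d B \is a fin_num by apply: fin; exact: subsetUr.
rewrite -leeBrDr//; apply: ge_ereal_sup => _ [e1 /= e10 <-].
have A1fin : hausdorff_delta d e1 A \is a fin_num.
  rewrite ge0_fin_numE ?hausdorff_delta_ge0//.
  apply: le_lt_trans (hausdorff_delta_le _ _ e10) _.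
  by rewrite -ge0_fin_numE ?hausdorff_ge0//; apply: fin; exact: subsetUl.
rewrite leeBrDr// addeC -leeBrDr//; apply: ge_ereal_sup => _ [e2 /= e20 <-].
rewrite leeBrDr// addeC.
pose m := Num.min (Num.min e1 e2) (e / 2)%R.
have m0 : (0 < m)%R by rewrite !lt_min e10 e20 divr_gt0.
have me : (m < e)%R.
  by rewrite /m gt_min ltr_pdivrMr// mulr2n mulrDr mulr1 ltrDl e0 orbT.
have anti D e' : (m <= e')%R -> hausdorff_delta d e' D <= hausdorff_delta d m D.
  move=> me'; apply: ereal_inf_le_tmp => _ [C [AC Cd] <-]; exists C => //.
  by split=> // i; apply: le_trans (Cd i) _; rewrite lee_fin.
apply: le_trans (hausdorff_delta_le _ _ m0).
apply: le_trans (hausdorff_delta_separated _ me sep).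
by apply: leeD; apply: anti; rewrite /m !ge_min lexx ?orbT.
Qed.

(** The bound is a reciprocal so that it places [x] directly in one of the layers [A n] of the next
    proof. *)
Lemma closed_enorm_dist C x : closed C -> ~ C x ->
  exists n : nat, forall c, C c -> (n.+1%:R^-1 <= enorm (x - c))%R.
Proof.
move=> cC Cx; have : nbhs x (~` C).
  by apply: open_nbhs_nbhs; split => //; exact: closed_openC.
move=> /nbhs_ballP[e /= e0 eC].
have [n en] : exists n : nat, (n.+1%:R^-1 < e)%R.
  have [n _ /(_ n (leqnn n))/= ?] := near_infty_natSinv_lt (PosNum e0).
  by exists n.
exists n => c Cc; rewrite leNgt; apply/negP => nc; apply: (eC c) => //.
(* The balls of the topology are those of the maximum norm, so the bound is checked entry by
   entry. *)
split => // i j; rewrite ord1 /ball/=.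
have := ler_coord_enorm (x - c) j; rewrite !mxE => /le_lt_trans; apply.
exact: lt_trans en.
Qed.

(* Caratheodory's criterion.  [A n] is the part of [X] at distance at least
   1/(n+1) of [C]; the shells [A n.+1 \ A n] have summable measures because
   every second one is separated from the previous ones. *)
Lemma closed_caratheodory d C : closed C -> (hausdorff_outer d).-caratheodory C.
Proof.
move=> cC; apply: le_caratheodory_measurable => X.
change (hausdorff d (X `&` C) + hausdorff d (X `&` ~` C) <= hausdorff d X).
have [->|Xoo] := eqVneq (hausdorff d X) +oo; first by rewrite leey.
have Xfin : hausdorff d X \is a fin_num.
  by rewrite ge0_fin_numE ?hausdorff_ge0// ltey.
pose A n := X `&` [set x | forall c, C c -> (n.+1%:R^-1 <= enorm (x - c))%R].
pose D n := A n.+1 `\` A n.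
have incr m n : (m <= n)%N -> (n.+1%:R^-1 <= m.+1%:R^-1 :> R)%R.
  by move=> mn; rewrite lef_pV2 ?posrE// ler_nat.
have AA n : A n `<=` A n.+1.
  move=> x [Xx xC]; split=> // c /xC; apply: le_trans; exact: incr.
have AX n : A n `<=` X by move=> x [].
(* A point of [D n.+1] is closer than 1/(n+2) to some point of [C], a point of [A n] is at least
   1/(n+1) away from it; the triangle inequality leaves the gap [e0]. *)
have sepD n : hausdorff d (A n) + hausdorff d (D n.+1) <= hausdorff d (A n.+2).
  have e0 : (0 < n.+1%:R^-1 - n.+2%:R^-1 :> R)%R.
    by rewrite subr_gt0 ltf_pV2 ?posrE// ltr_nat.
  apply: le_trans (hausdorff_separated d e0 _) _; last first.
    apply: le_hausdorff => x [/AA/AA//|[]//].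
  move=> x y [Xx xC] [[Xy _] nyA]; rewrite leNgt; apply/negP => xy; apply: nyA.
  split=> // c Cc; rewrite leNgt; apply/negP => yc; have := xC _ Cc.
  have -> : (x - c = (x - y) + (y - c))%R by rewrite addrA subrK.
  rewrite leNgt => /negP; apply; apply: le_lt_trans (enormD _ _) _.
  by apply: lt_le_trans (ltrD xy yc) _; rewrite subrK.
(* In the induction step [sepD] lets [A n] absorb the new shell and become [A n.+2]. The two terms
   on the right take care of shells of either parity. *)
have S n : \sum_(0 <= i < n.+1) hausdorff d (D i) <=
    hausdorff d (A n.+1) + hausdorff d (A n).
  elim: n => [|n IH].
    rewrite big_nat1; apply: le_trans (le_hausdorff d (@subDsetl _ _ _)) _.
    by rewrite leeDl// hausdorff_ge0.
  rewrite big_nat_recr//=; apply: le_trans (leeD IH (lexx _)) _.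
  by rewrite -addeA addeC; apply: leeD => //; exact: sepD.
have Doo : \sum_(i <oo) hausdorff d (D i) < +oo.
  apply: (@le_lt_trans _ _ (hausdorff d X + hausdorff d X)); last first.
    by rewrite -ge0_fin_numE ?adde_ge0 ?hausdorff_ge0// fin_numD Xfin.
  apply: lime_le; first by apply: is_cvg_nneseries => *; exact: hausdorff_ge0.
  apply: nearW => -[|n]; first by rewrite big_nil adde_ge0// hausdorff_ge0.
  by apply: le_trans (S n) _; apply: leeD; apply: le_hausdorff.
(* [A n] is separated from [X]&[C], and what [X] has outside [C] and [A n] lies in the shells from
   [n] on, whose total measure tends to 0. *)
have cover n : hausdorff d (X `&` C) + hausdorff d (X `&` ~` C) <=
    hausdorff d X + \sum_(n <= i <oo) hausdorff d (D i).
  apply: (@le_trans _ _ (hausdorff d (X `&` C) + (hausdorff d (A n) +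
      \sum_(n <= i <oo) hausdorff d (D i)))); last first.
    rewrite addeA; apply: leeD => //.
    have e0 : (0 < n.+1%:R^-1 :> R)%R by rewrite invr_gt0.
    rewrite addeC; apply: le_trans (hausdorff_separated d e0 _) _.
      by move=> x y [_ xC] [_ Cy]; exact: xC.
    by apply: le_hausdorff => x [[]|[]].
  apply: leeD => //.
  have tail := outer_measure_sigma_subadditive_tail (hausdorff_outer d) n D.
  apply: le_trans (leeD (lexx _) tail).
  apply: le_trans (outer_measureU2 (hausdorff_outer d) _ _).
  apply: le_outer_measure => x [Xx /(closed_enorm_dist cC)[m xm]].
  have Amx : A m x by [].
  (* Descent to the first layer containing [x]: it is either within [A n], or produces a shell of
     index at least [n]. *)
  elim: m Amx {xm} => [A0x|m IH Amx].
    by left; elim: (n) => // k; exact: AA.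
  have [/IH//|nAx] := pselect (A m x).
  have [nm|mn] := leqP n m; first by right; exists m => //=; apply/negP; rewrite -leqNgt.
  by left; rewrite -(subnK mn); elim: (_ - _)%N => //= k; rewrite addSn; exact: AA.
have tail0 := nneseries_tail_cvg Doo (fun k _ => hausdorff_ge0 d (D k)).
rewrite -[leRHS]adde0.
have lim : hausdorff d X + \sum_(n <= i <oo) hausdorff d (D i) @[n --> \oo] -->
    hausdorff d X + 0.
  apply: cvgeD; [by rewrite fin_num_adde_defr|exact: cvg_cst|exact: tail0].
rewrite -(cvg_lim _ lim)//; apply: lime_ge; first by apply/cvg_ex; eexists; exact: lim.
exact: nearW.
Qed.

End HausdorffTheory.

(** * The involution and the planes *)

Section Sphere.
Context {R : realType} {n : nat}.
Implicit Types (a b x y : 'rV[R]_n.+1).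

Lemma usphereE x : usphere x = (dotp x x = 1).
Proof.
apply/propext; split=> [x1|x1]; first by rewrite -sqr_enorm x1 expr1n.
by rewrite /usphere/= /enorm x1 sqrtr1.
Qed.

Lemma enorm_lt1 x : (enorm x < 1) = (dotp x x < 1).
Proof. by rewrite -sqr_enorm expr_lt1// enorm_ge0. Qed.

(** Hence [hyperplane b] misses the closed unit ball, and the denominator of [phi b] is positive
    there. *)
Lemma enorm_le1_dotp_lt1 b x : dotp b b < 1 -> enorm x <= 1 -> dotp x b < 1.
Proof.
rewrite -enorm_lt1 => b1 x1; apply: le_lt_trans (dotp_le_enorm _ _) _.
by apply: le_lt_trans b1; rewrite ler_piMl ?enorm_ge0.
Qed.

Lemma usphere_dotp_lt1 b x : dotp b b < 1 -> usphere x -> dotp x b < 1.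
Proof. by move=> b1 x1; apply: enorm_le1_dotp_lt1 => //; rewrite x1. Qed.

Lemma scoef_gt0 b : dotp b b < 1 -> 0 < scoef b.
Proof. by move=> b1; rewrite sqrtr_gt0 sqr_enorm subr_gt0. Qed.

Lemma dotp_scoef b : dotp b b < 1 -> dotp b b = 1 - scoef b ^+ 2.
Proof. by move=> b1; rewrite sqr_sqrtr sqr_enorm ?subKr// subr_ge0 ltW. Qed.

(** With the projections eliminated, [phi b x] is a combination of [b] and [x], so all dot products
    of images become rational expressions. *)
Lemma phiE b x : phi b x = (1 - dotp x b)^-1 *:
  ((1 - (1 - scoef b) * (dotp x b / dotp b b)) *: b - scoef b *: x).
Proof.
rewrite /phi /Qproj /Pproj sqr_enorm (dotpC b x); congr (_ *: _).
by apply/rowP => i; rewrite !mxE; ring.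
Qed.

(** Valid off the sphere as well: the case [x = y] shows that [phi b] preserves both the sphere and
    the ball. *)
Lemma dotp_phi b x y : 0 < dotp b b < 1 -> dotp x b != 1 -> dotp y b != 1 ->
  1 - dotp (phi b x) (phi b y) =
  scoef b ^+ 2 * (1 - dotp x y) / ((1 - dotp x b) * (1 - dotp y b)).
Proof.
move=> /andP[b0 b1] xb yb; rewrite !phiE !(dotpZl, dotpZr, dotpBl, dotpBr).
(* Replacing b.b by 1 - s^2 leaves no relation between the remaining quantities, so [field] can
   conclude. *)
rewrite (dotpC b y); move: b0; rewrite (dotp_scoef b1) => b0.
by field; rewrite (gt_eqF b0) !subr_eq0 ![1 == _]eq_sym xb yb.
Qed.

(** This is the previous identity at y = 0, as [phi b] sends 0 to [b]. *)
Lemma dotp_phi_center b x : 0 < dotp b b < 1 -> dotp x b != 1 ->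
  1 - dotp (phi b x) b = scoef b ^+ 2 / (1 - dotp x b).
Proof.
move=> /andP[b0 b1] xb; rewrite !phiE !(dotpZl, dotpBl).
move: b0; rewrite (dotp_scoef b1) => b0.
by field; rewrite (gt_eqF b0) subr_eq0 eq_sym xb.
Qed.

Lemma phi_notin_hyperplane b x : 0 < dotp b b < 1 -> dotp x b != 1 ->
  dotp (phi b x) b != 1.
Proof.
move=> b01 xb; rewrite eq_sym -subr_eq0 dotp_phi_center// mulf_eq0 invr_eq0.
rewrite subr_eq0 [1 == _]eq_sym (negbTE xb) orbF expf_eq0/=.
by case/andP: b01 => _ b1; rewrite gt_eqF ?scoef_gt0.
Qed.

Lemma phiK b x : 0 < dotp b b < 1 -> dotp x b != 1 -> phi b (phi b x) = x.
Proof.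
move=> /[dup] b01 /andP[b0 b1] xb; have := dotp_phi_center b01 xb.
have s0 := scoef_gt0 b1; have xb1 : 1 - dotp x b != 0 by rewrite subr_eq0 eq_sym.
rewrite [phi b (phi b x)]phiE => e; rewrite e.
have -> : dotp (phi b x) b = 1 - scoef b ^+ 2 / (1 - dotp x b) by rewrite -e subKr.
rewrite phiE; move: b0; rewrite (dotp_scoef b1) => b0.
apply/rowP => i; rewrite !mxE; field.
by rewrite xb1 (gt_eqF s0) (gt_eqF b0).
Qed.

Lemma phi_usphere b x : 0 < dotp b b < 1 -> usphere x -> usphere (phi b x).
Proof.
move=> /[dup] b01 /andP[_ b1] Sx; have xb := lt_eqF (usphere_dotp_lt1 b1 Sx).
move: Sx; rewrite !usphereE => Sx; apply/esym/eqP.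
by rewrite -subr_eq0 dotp_phi ?xb// Sx subrr mulr0 mul0r.
Qed.

(** The conformal factor of [phi b] on the sphere, in the exact shape of the weight of
    [Mtransform]. *)
Definition dilation b y : R := scoef b / (1 - dotp b y).

Lemma dilation_gt0 b x : dotp b b < 1 -> usphere x -> 0 < dilation b x.
Proof.
move=> b1 Sx; rewrite divr_gt0 ?scoef_gt0// subr_gt0 dotpC.
exact: usphere_dotp_lt1.
Qed.

Lemma dilation_phi b x : 0 < dotp b b < 1 -> usphere x ->
  dilation b (phi b x) * dilation b x = 1.
Proof.
move=> /[dup] b01 /andP[_ b1] Sx; have xb := lt_eqF (usphere_dotp_lt1 b1 Sx).
rewrite /dilation (dotpC b (phi b x)) dotp_phi_center ?xb// (dotpC b x).
by field; rewrite subr_eq0 eq_sym xb gt_eqF ?scoef_gt0.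
Qed.

Lemma enorm_phiB b x y : 0 < dotp b b < 1 -> usphere x -> usphere y ->
  enorm (phi b x - phi b y) ^+ 2 =
  dilation b x * dilation b y * enorm (x - y) ^+ 2.
Proof.
move=> /[dup] b01 /andP[_ b1] Sx Sy.
have xb := lt_eqF (usphere_dotp_lt1 b1 Sx).
have yb := lt_eqF (usphere_dotp_lt1 b1 Sy).
(* On the sphere distances are functions of dot products, which reduces the claim to [dotp_phi]. *)
have sphB (u v : 'rV[R]_n.+1) : usphere u -> usphere v ->
    enorm (u - v) ^+ 2 = 2 * (1 - dotp u v).
  rewrite !usphereE => Su Sv; rewrite sqr_enorm !(dotpBl, dotpBr) Su Sv.
  by rewrite (dotpC v u); ring.
rewrite !sphB//; try exact: phi_usphere.
rewrite dotp_phi ?xb ?yb// /dilation !(dotpC b).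
by field; rewrite !subr_eq0 ![1 == _]eq_sym xb yb.
Qed.

Lemma phi_lipschitz b (v : R) x y : 0 < dotp b b < 1 ->
  usphere x -> usphere y -> dilation b x <= v -> dilation b y <= v ->
  enorm (phi b x - phi b y) <= v * enorm (x - y).
Proof.
move=> /[dup] b01 /andP[_ b1] Sx Sy xv yv.
have v0 : 0 < v by apply: lt_le_trans xv; exact: dilation_gt0.
rewrite -(@ler_pXn2r _ 2) ?nnegrE ?mulr_ge0 ?enorm_ge0 ?(ltW v0)//.
rewrite enorm_phiB// exprMn; apply: ler_wpM2r; first exact: sqr_ge0.
rewrite expr2.
by apply: ler_pM => //; exact/ltW/dilation_gt0.
Qed.

Lemma enorm_star a : 1 < enorm a -> 0 < dotp (star a) (star a) < 1.
Proof.
move=> a1; rewrite /star dotpZl dotpZr -sqr_enorm mulrA -mulrA.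
have a2 : 1 < enorm a ^+ 2 by rewrite expr_gt1// enorm_ge0.
have a0 : 0 < enorm a ^+ 2 by rewrite (lt_trans ltr01).
by rewrite mulVf ?gt_eqF// mulr1 invr_gt0 a0 invf_lt1.
Qed.

Lemma dotp_starE a : 1 < enorm a -> dotp a (star a) = 1.
Proof.
move=> a1; rewrite /star dotpZr -sqr_enorm mulVf// gt_eqF//.
by rewrite exprn_gt0// (lt_trans ltr01).
Qed.

Lemma starE a : 1 < enorm a -> star a = dotp (star a) (star a) *: a.
Proof. by move=> a1; rewrite {2}/star dotpZl dotp_starE// mulr1. Qed.

Lemma phi_star_affine a x : 1 < enorm a -> dotp x (star a) != 1 ->
  phi (star a) x = (1 - dotp x (star a))^-1 *:
    ((dotp (star a) (star a) - (1 - scoef (star a)) * dotp x (star a)) *: a -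
      scoef (star a) *: x).
Proof.
move=> a1 xb; rewrite phiE; have /andP[b0 _] := enorm_star a1.
congr (_ *: (_ - _)); rewrite [X in _ *: X = _](starE a1) scalerA; congr (_ *: _).
by field; rewrite gt_eqF.
Qed.

(* With q a point of t in the ball, v0 the multiple of q - a with v0.b = 1 and
   W the part of the direction V of t orthogonal to b, the image plane is
   s_b v0 + (W + <a>). *)
Lemma phi_plane_exists k a (t : set 'rV[R]_n.+1) : 1 < enorm a ->
  planes_through k a t ->
  exists z, planes_parallel k a z /\
    phi (star a) @` (t `\` hyperplane (star a)) = z `\` hyperplane (star a).
Proof.
move=> a1 [[p [V [dimV ->]]] [/= Vap [q [/= Vqp qB]]]].
set b := star a; have ab : dotp a b = 1 by exact: dotp_starE.
have b01 : 0 < dotp b b < 1 by exact: enorm_star.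
have /andP[b0 b1] := b01.
have Vt x : affine_plane p V x <-> x - a \in V.
  split => [Vxp|Vxa].
    have -> : x - a = (x - p) - (a - p) by rewrite opprB subrKA.
    exact: rpredB.
  have -> : affine_plane p V x = (x - a + (a - p) \in V) by rewrite subrKA.
  exact: rpredD.
have qb : dotp q b < 1 by apply: enorm_le1_dotp_lt1 => //; exact: ltW.
have qb0 : dotp q b - 1 != 0 by rewrite subr_eq0 lt_eqF.
(* Since q.b < 1 = a.b, the direction q - a is not orthogonal to b and can be normalised. *)
have [v0 Vv0 v0b] : exists2 v0, v0 \in V & dotp v0 b = 1.
  exists ((dotp q b - 1)^-1 *: (q - a)); first by rewrite rpredZ//; apply/Vt.
  by rewrite dotpZl dotpBl ab mulVf.
pose l : 'rV[R]_n.+1 -> R^o := fun x => dotp x b.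
have ll : linear l.
  by move=> c x y; rewrite /l dotpDl dotpZl.
pose lL := GRing.isLinear.Build R 'rV[R]_n.+1 R^o *:%R l ll.
pose lf : {linear 'rV[R]_n.+1 -> R^o} := HB.pack l lL.
have lkerE x : (x \in lker (linfun lf)) = (dotp x b == 0).
  by rewrite memv_ker lfunE.
pose W := (V :&: lker (linfun lf))%VS.
have WE x : (x \in W) = (x \in V) && (dotp x b == 0) by rewrite memv_cap lkerE.
(* The linear form x.b has rank exactly 1 on [V], because it takes the value 1 at [v0]. *)
have dimW : (\dim W).+1 = k.
  rewrite -dimV -(limg_ker_dim (linfun lf) V) -addn1; congr (_ + _)%N.
  apply/esym/eqP; rewrite eqn_leq; apply/andP; split.
    by apply: leq_trans (dimvS (subvf _)) _; rewrite dimvf.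
  rewrite lt0n dimv_eq0; apply/negP => /eqP lV0.
  have : linfun lf v0 \in (linfun lf @: V)%VS by exact: memv_img.
  by rewrite lV0 memv0 lfunE/= /l v0b oner_eq0.
have a0 : a != 0.
  apply: contraTneq a1 => ->; rewrite /enorm /dotp big1 ?sqrtr0 ?ltr10// => i _.
  by rewrite mxE mul0r.
have dimWa : \dim (W + <[a]>)%VS = k.
  rewrite dimv_disjoint_sum.
    by rewrite dim_vline a0 addn1 dimW.
  apply/eqP; rewrite -subv0; apply/subvP => w; rewrite memv_cap WE => /andP[/andP[_ wb]].
  move=> /vlineP[c wE]; move: wb; rewrite wE dotpZl ab mulr1 => /eqP ->.
  by rewrite scale0r mem0v.
pose s := scoef b.
pose z := affine_plane (s *: v0) (W + <[a]>)%VS.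
have zE : phi b @` (affine_plane p V `\` hyperplane b) = z `\` hyperplane b.
  apply/seteqP; split=> [_ [x [/Vt Vx xH] <-]|y [zy yH]].
    have xb : dotp x b != 1 by apply/eqP.
    split; last by apply/eqP; exact: phi_notin_hyperplane.
    rewrite /z /affine_plane/= phi_star_affine// -/b -/s.
    have xb1 : 1 - dotp x b != 0 by rewrite subr_eq0 eq_sym.
    (* (x - a) / (x.b - 1) is in [V] and has product 1 with b, like [v0]; their difference is
       therefore in [W]. *)
    have -> : (1 - dotp x b)^-1 *:
        ((dotp b b - (1 - s) * dotp x b) *: a - s *: x) - s *: v0 =
        s *: ((dotp x b - 1)^-1 *: (x - a) - v0) +
        ((1 - dotp x b)^-1 * (dotp b b - (1 - s) * dotp x b - s)) *: a.
      apply/rowP => i; rewrite !mxE; field.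
      by rewrite xb1 subr_eq0 xb.
    apply: memv_add; last by rewrite memvZ// memv_line.
    rewrite memvZ// WE rpredB ?rpredZ//= dotpBl v0b dotpZl dotpBl ab.
    by rewrite mulVf ?subrr// -opprB oppr_eq0.
  have yb : dotp y b != 1 by apply/eqP.
  exists (phi b y); last exact: phiK.
  split; last by apply/eqP; exact: phi_notin_hyperplane.
  apply/Vt; move: zy; rewrite /z /affine_plane/= => /memv_addP[w].
  rewrite WE => /andP[Vw /eqP wb] [_ /vlineP[c ->] yE].
  have {}yE : y = s *: v0 + w + c *: a by rewrite -addrA -yE addrC subrK.
  have ybE : dotp y b = s + c.
    by rewrite yE !dotpDl !dotpZl v0b wb ab !mulr1 addr0.
  (* The coefficient of [a] cancels because y.b = s + c, and what remains lies in [V]. *)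
  have -> : phi b y - a = (- s / (1 - dotp y b)) *: (s *: v0 + w).
    rewrite phi_star_affine// -/b -/s (dotp_scoef b1) -/s ybE yE.
    move: yb; rewrite ybE => yb; apply/rowP => i; rewrite !mxE; field.
    by rewrite subr_eq0 eq_sym yb.
  by rewrite rpredZ// rpredD// rpredZ.
exists z; split=> //; split.
  exists (s *: v0), (W + <[a]>)%VS; split=> //; split=> //.
  by apply: (subvP (addvSr _ _)); exact: memv_line.
have [zq _] : (z `\` hyperplane b) (phi b q).
  by rewrite -zE; exists q => //; split=> //; apply/eqP; rewrite lt_eqF.
exists (phi b q); split=> //.
rewrite /uball/= enorm_lt1 -subr_gt0 dotp_phi ?lt_eqF//.
rewrite divr_gt0// ?mulr_gt0 ?exprn_gt0 ?scoef_gt0 ?subr_gt0//.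
by rewrite -enorm_lt1.
Qed.

(** The sphere misses [hyperplane (star a)], so the equation defining [phi_plane] determines the
    section, whichever plane [xget] returns. *)
Lemma usphere_phi_plane k a (t : set 'rV[R]_n.+1) : 1 < enorm a ->
  planes_through k a t ->
  usphere `&` phi_plane k a t = phi (star a) @` (usphere `&` t).
Proof.
move=> a1 /(phi_plane_exists a1)[z zP]; have /andP[b0 b1] := enorm_star a1.
have [_ zE] : planes_parallel k a (phi_plane k a t) /\
    phi (star a) @` (t `\` hyperplane (star a)) =
    phi_plane k a t `\` hyperplane (star a).
  exact: (@xgetI _ set0 [set z | planes_parallel k a z /\
    phi (star a) @` (t `\` hyperplane (star a)) =
    z `\` hyperplane (star a)] z zP).
have SH x : usphere x -> ~ hyperplane (star a) x.
  by move=> Sx; apply/eqP; rewrite lt_eqF// usphere_dotp_lt1.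
apply/seteqP; split=> [y [Sy zy]|_ [x [Sx tx] <-]].
  have : (phi_plane k a t `\` hyperplane (star a)) y by split=> //; exact: SH.
  rewrite -zE => -[x [tx xH] xy]; exists x => //; split=> //.
  rewrite -(@phiK (star a) x) ?xy ?enorm_star//; last exact/eqP.
  by apply: phi_usphere => //; exact: enorm_star.
split; first by apply: phi_usphere => //; exact: enorm_star.
have : (phi_plane k a t `\` hyperplane (star a)) (phi (star a) x); last by case.
by rewrite -zE; exists x => //; split=> //; exact: SH.
Qed.

End Sphere.

(** * Borel sets and functions *)

Section Borel.
Context {R : realType} {N : nat}.
Local Notation G := (g_sigma_algebraType (@open 'rV[R]_N)).
Local Notation T d := (caratheodory_type (@hausdorff_outer R N d)).

Lemma borel_caratheodory d (A : set G) : measurable A ->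
  measurable (A : set (T d)).
Proof.
move=> mA; have : <<s @open 'rV[R]_N >> `<=` (@measurable _ (T d)).
  apply: smallest_sub; first exact: sigma_algebra_measurable.
  move=> U oU; rewrite -(setCK U); apply: measurableC.
  by apply: closed_caratheodory; exact: open_closedC.
exact.
Qed.

Lemma measurable_borel_id d : measurable_fun setT (id : T d -> G).
Proof. by move=> _ A mA; rewrite setTI; exact: borel_caratheodory. Qed.

(** The same measure on Borel sets only, as a pushforward under the identity; the change of
    variables takes place here. *)
Definition hausdorff_borel d : {measure set G -> \bar R} :=
  measure_function_pushforward__canonical__measure_function_Measure
    (hausdorff_measure d) (@measurable_borel_id d).

Lemma ge0_integral_hausdorff_borel d (D : set G) (f : G -> \bar R) :
  measurable D -> measurable_fun D f -> (forall x, D x -> (0 <= f x)%E) ->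
  (\int[hausdorff_measure d]_(x in D) f x =
   \int[hausdorff_borel d]_(x in D) f x)%E.
Proof.
move=> mD mf f0.
rewrite (@ge0_integral_pushforward _ _ _ _ _ _ (@measurable_borel_id d))//.
by move=> x; rewrite inE; exact: f0.
Qed.

Lemma open_borel (U : set 'rV[R]_N) : open U -> measurable (U : set G).
Proof. exact: sub_sigma_algebra. Qed.

Lemma closed_borel (C : set 'rV[R]_N) : closed C -> measurable (C : set G).
Proof. by move=> /closed_openC/open_borel/measurableC; rewrite setCK. Qed.

Lemma within_continuous_borel (D : set 'rV[R]_N) (f : 'rV[R]_N -> R) :
  measurable (D : set G) -> {within D, continuous f} ->
  measurable_fun (D : set G) f.
Proof.
move=> mD /continuousP cf; apply: (measurability _ (RGenOpens.measurableE R)).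
move=> _ [_ [a [b ->] <-]].
have /open_subspaceP[V oV VD] : open (from_subspace D f @^-1` `]a, b[%classic).
  by apply: cf; exact: interval_open.
rewrite setIC -VD; apply: measurableI => //; exact: open_borel.
Qed.

End Borel.

(** * Closedness of affine planes and of the sphere *)

Section ClosedSets.
Context {R : realType} {n : nat}.

Lemma closed_affine_plane (p : 'rV[R]_n.+1) (V : {vspace 'rV[R]_n.+1}) :
  closed (affine_plane p V).
Proof.
(* [L] vanishes exactly on [V]; the vectors [w j] represent its coordinates, which gives linear
   equations for the plane. *)
pose L (v : 'rV[R]_n.+1) := v - projv V v.
pose w j : 'rV[R]_n.+1 := \row_i L (delta_mx 0 i) 0 j.
have Lw v j : L v 0 j = dotp v (w j).
  rewrite /L {1 2}(row_sum_delta v) linear_sum/= -sumrB summxE.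
  by apply: eq_bigr => i _; rewrite linearZ/= -scalerBr !mxE.
have -> : affine_plane p V = \bigcap_j [set x | dotp x (w j) = dotp p (w j)].
  apply/seteqP; split=> [x Vx j _|x xV] /=.
    apply/eqP; rewrite -subr_eq0 -dotpBl -Lw /L projv_id// subrr mxE.
    by [].
  rewrite /affine_plane/=; suff -> : x - p = projv V (x - p) by exact: memv_proj.
  apply/eqP; rewrite -subr_eq0; apply/eqP/rowP => j.
  by rewrite [LHS]Lw dotpBl (xV j Logic.I) subrr mxE.
apply: closed_bigI => j _.
have -> : [set x | dotp x (w j) = dotp p (w j)] =
    (fun x => dotp x (w j)) @^-1` [set dotp p (w j)] by [].
by apply: (continuous_closedP _).1; [exact: continuous_dotp|exact: closed_eq].
Qed.

Lemma closed_usphere : closed (@usphere R n).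
Proof.
have -> : @usphere R n = (fun x => dotp x x) @^-1` [set 1].
  by apply/seteqP; split=> x; rewrite usphereE.
by apply: (continuous_closedP _).1; [exact: continuous_dotp_self|exact: closed_eq].
Qed.

End ClosedSets.

Lemma lee_exp_gt1 {R : realType} d (x y : \bar R) : (0 <= y)%E ->
  (forall rho : R, 1 < rho -> (x <= (rho ^+ d)%:E * y)%E) -> (x <= y)%E.
Proof.
move=> y0 H; have [->|yoo] := eqVneq y +oo%E; first by rewrite leey.
have yfin : y \is a fin_num by rewrite ge0_fin_numE// ltey.
move: y yfin y0 H {yoo} => [r| |]// _ _; case: x => [x| |] H; last 2 first.
  - by have := H 2; rewrite ltr1n => /(_ isT); rewrite -EFinM leye_eq.
  - by rewrite leNye.
rewrite lee_fin.
have lim : (1 + k.+1%:R^-1) ^+ d * r @[k --> \oo] --> (1 + 0) ^+ d * r.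
  apply: cvgM; last exact: cvg_cst.
  apply: (@cvg_comp _ _ _ (fun k : nat => 1 + k.+1%:R^-1) (fun x : R => x ^+ d)).
    by apply: cvgD; [exact: cvg_cst|exact: cvg_harmonic].
  exact: exprn_continuous.
move: lim; rewrite addr0 expr1n mul1r => /cvgr_to_ge; apply.
apply: nearW => k; rewrite -lee_fin EFinM; apply: H.
by rewrite ltrDl invr_gt0.
Qed.

(** * Change of variables on the sphere *)

Section ChangeOfVariables.
Context {R : realType} {n : nat} (b : 'rV[R]_n.+1).
Hypothesis b01 : 0 < dotp b b < 1.
Local Notation G := (g_sigma_algebraType (@open 'rV[R]_n.+1)).
Local Notation S := (@usphere R n).

Lemma continuous_phi : {within S, continuous (phi b)}.
Proof.
apply: continuous_in_subspaceT => x /[!inE] Sx.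
have /andP[_ b1] := b01; have xb := usphere_dotp_lt1 b1 Sx.
rewrite (_ : phi b = fun x => (1 - dotp x b)^-1 *:
  ((1 - (1 - scoef b) * (dotp x b / dotp b b)) *: b - scoef b *: x)); last first.
  by apply/funext => y; exact: phiE.
have cb : {for x, continuous (fun x => dotp x b)} by exact: continuous_dotp.
have cst1 (c : R) : {for x, continuous (fun=> c : R)} by exact: cst_continuous.
have cN : {for x, continuous (fun x => (1 - dotp x b)^-1)}.
  apply: continuousV; first by rewrite subr_eq0 eq_sym lt_eqF.
  exact: (continuousB (cst1 1) cb).
have cE : {for x, continuous (fun x => 1 - (1 - scoef b) * (dotp x b / dotp b b))}.
  apply: (continuousB (cst1 1)); apply: (continuousM (cst1 _)).
  exact: (continuousM cb (cst1 _)).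
have cA := continuousZ cE (@cst_continuous _ _ b x).
have cI : {for x, continuous (@id 'rV[R]_n.+1)} by exact: cvg_id.
have cB := continuousZ (cst1 (scoef b)) cI.
exact: (continuousZ cN (continuousB cA cB)).
Qed.

Lemma continuous_dilation : {within S, continuous (dilation b)}.
Proof.
apply: continuous_in_subspaceT => x /[!inE] Sx.
have /andP[_ b1] := b01; have xb := usphere_dotp_lt1 b1 Sx.
rewrite (_ : dilation b = fun x => scoef b * (1 - dotp x b)^-1); last first.
  by apply/funext => y; rewrite /dilation dotpC.
have cb : {for x, continuous (fun x => dotp x b)} by exact: continuous_dotp.
have cst1 (c : R) : {for x, continuous (fun=> c : R)} by exact: cst_continuous.
apply: (continuousM (cst1 _)); apply: continuousV.
  by rewrite subr_eq0 eq_sym lt_eqF.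
exact: (continuousB (cst1 1) cb).
Qed.

(* Extended by the identity, phi becomes an involution of the whole space. *)
Definition sphere_phi (x : 'rV[R]_n.+1) := if x \in S then phi b x else x.

Lemma sphere_phiE x : S x -> sphere_phi x = phi b x.
Proof. by move=> Sx; rewrite /sphere_phi mem_set. Qed.

Lemma sphere_phiK x : sphere_phi (sphere_phi x) = x.
Proof.
have /andP[_ b1] := b01.
rewrite /sphere_phi; case: (boolP (x \in S)) => [|/negbTE -> //].
rewrite inE => Sx; rewrite mem_set; last exact: phi_usphere.
by rewrite phiK// lt_eqF// usphere_dotp_lt1.
Qed.

Lemma sphere_phi_usphere x : S x -> S (sphere_phi x).
Proof. by move=> Sx; rewrite sphere_phiE//; exact: phi_usphere. Qed.

(** Turns images into preimages, so that images of Borel sets are Borel. *)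
Lemma image_sphere_phi (A : set 'rV[R]_n.+1) :
  sphere_phi @` A = sphere_phi @^-1` A.
Proof.
apply/seteqP; split=> [_ [x Ax <-]|x Ax]; first by rewrite /preimage/= sphere_phiK.
by exists (sphere_phi x) => //; rewrite sphere_phiK.
Qed.

Lemma sphere_phi_imageK (A : set 'rV[R]_n.+1) :
  sphere_phi @` (sphere_phi @` A) = A.
Proof.
rewrite image_comp (_ : _ \o _ = id) ?image_id//.
by apply/funext => x /=; exact: sphere_phiK.
Qed.

Lemma measurable_usphere : measurable (S : set G).
Proof. apply: closed_borel; exact: closed_usphere. Qed.

Lemma measurable_sphere_phi : measurable_fun setT (sphere_phi : G -> G).
Proof.
apply: (@measurability _ _ G G _ _ (@open 'rV[R]_n.+1)) => // _ [U oU <-].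
have /continuousP/(_ _ oU)/open_subspaceP[V oV VS] := continuous_phi.
rewrite (_ : _ `&` _ = (V `&` S) `|` (U `\` S)); last first.
  rewrite VS setTI; apply/seteqP; split=> [x|x [[]|[]]]; rewrite /preimage/= /sphere_phi.
  - by case: ifPn => [|/negP]; rewrite inE => Sx Ux; [left|right].
  - by move=> Ux Sx; rewrite mem_set.
  - by move=> Ux Sx; rewrite memNset.
apply: measurableU.
  by apply: measurableI; [exact: open_borel|exact: measurable_usphere].
by apply: measurableD; [exact: open_borel|exact: measurable_usphere].
Qed.

Local Notation mu d := (hausdorff_borel d).
Local Open Scope ereal_scope.

Lemma measurable_preimage_sphere_phi (B : set G) : measurable B ->
  measurable (sphere_phi @^-1` B : set G).
Proof.
by move=> mB; rewrite -[X in measurable X]setTI; exact: measurable_sphere_phi.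
Qed.

(** The Lipschitz bound on sets is an inequality [m1 <= m2] between two measures, restriction to the
    image and scaled pushforward; monotonicity of the integral in the measure does the rest. *)
Lemma integral_sphere_phi_slab d (v : R) (B : set G) (f : G -> \bar R) :
  (0 < v)%R -> measurable B -> B `<=` S ->
  (forall x, B x -> (dilation b x <= v)%R) ->
  measurable_fun setT f -> (forall x, 0 <= f x) ->
  \int[mu d]_(x in sphere_phi @` B) f x <=
  (v ^+ d)%:E * \int[mu d]_(x in B) f (sphere_phi x).
Proof.
move=> v0 mB BS Bv mf f0; rewrite image_sphere_phi; set D := _ @^-1` _.
have mD : measurable (D : set G) by exact: measurable_preimage_sphere_phi.
have vd0 : (0 <= v ^+ d)%R by rewrite exprn_ge0// ltW.
pose m1 : {measure set G -> \bar R} := mrestr (mu d) mD.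
pose m2 : {measure set G -> \bar R} := mscale (NngNum vd0)
  (measure_function_pushforward__canonical__measure_function_Measure
    (mu d) measurable_sphere_phi).
have m12 E : measurable E -> m1 E <= m2 E.
  move=> mE; change (hausdorff d (E `&` D) <=
    (v ^+ d)%:E * hausdorff d (sphere_phi @^-1` E)).
  (* [E]&[D] is the image of a part of [B], where the dilation is at most [v]. *)
  have {1}-> : E `&` D = sphere_phi @` (sphere_phi @^-1` (E `&` D)).
    by rewrite -image_sphere_phi sphere_phi_imageK.
  apply: (@le_trans _ _ ((v ^+ d)%:E * hausdorff d (sphere_phi @^-1` (E `&` D)))).
    apply: hausdorff_lipschitz => // x y [_ Dx] [_ Dy].
    have Bx : B x by move: Dx; rewrite /D /preimage/= sphere_phiK.
    have By : B y by move: Dy; rewrite /D /preimage/= sphere_phiK.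
    rewrite !sphere_phiE; [|exact: BS..].
    by apply: phi_lipschitz; [| exact: BS | exact: BS | exact: Bv | exact: Bv].
  apply: lee_wpmul2l; first by rewrite lee_fin.
  by apply: le_hausdorff => x [].
have -> : \int[mu d]_(x in D) f x = \int[m1]_(x in D) f x.
  apply: eq_measure_integral => A mA AD.
  by rewrite /m1/= /mrestr; congr (hausdorff d _); apply/esym/setIidPl.
apply: le_trans (ge0_le_measure_integral m12 mD f0 mf) _.
rewrite ge0_integral_mscale//; last exact: measurable_funTS.
apply: lee_wpmul2l; first by rewrite lee_fin.
have BD : sphere_phi @^-1` D = B.
  by rewrite /D -!image_sphere_phi sphere_phi_imageK.
rewrite le_eqVlt; apply/orP; left; apply/eqP; rewrite -BD.
apply: (ge0_integral_pushforward measurable_sphere_phi) => //.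
exact: measurable_funTS.
Qed.

Lemma measurable_dilation_phi d (f : G -> \bar R) : measurable_fun setT f ->
  measurable_fun (S : set G)
    (fun x : G => (dilation b x ^+ d)%:E * f (sphere_phi x)).
Proof.
move=> mf; apply: emeasurable_funM.
  apply/measurable_EFinP; apply: measurable_funX.
  apply: within_continuous_borel; first exact: measurable_usphere.
  exact: continuous_dilation.
apply: measurable_funTS; exact: (measurableT_comp mf measurable_sphere_phi).
Qed.

Lemma dilation_phi_ge0 d (f : G -> \bar R) x : (forall x, 0 <= f x) -> S x ->
  0 <= (dilation b x ^+ d)%:E * f (sphere_phi x).
Proof.
move=> f0 Sx; have /andP[_ b1] := b01; rewrite mule_ge0// lee_fin exprn_ge0// ltW//.
exact: dilation_gt0.
Qed.

(** Induction on the number [m] of slabs, removing the top one, w <= lam < w rho. There the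
    Lipschitz factor (w rho)^d is at most rho^d lam^d, so [rho ^+ d] is the loss on every slab and
    does not accumulate. *)
Lemma integral_sphere_phi_le_ratio d (rho u : R) m (B : set G) (f : G -> \bar R) :
  (1 < rho)%R -> (0 < u)%R -> measurable B -> B `<=` S ->
  (forall x, B x -> (u <= dilation b x < u * rho ^+ m)%R) ->
  measurable_fun setT f -> (forall x, 0 <= f x) ->
  \int[mu d]_(x in sphere_phi @` B) f x <=
  (rho ^+ d)%:E *
    \int[mu d]_(x in B) ((dilation b x ^+ d)%:E * f (sphere_phi x)).
Proof.
move=> rho1 u0 + + + mf f0; have rho0 : (0 < rho)%R by exact: lt_trans rho1.
have rd0 : (0 <= rho ^+ d)%R by rewrite exprn_ge0// ltW.
elim: m B => [|m IH] B mB BS uB.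
  rewrite (_ : B = set0) ?image_set0 ?integral_set0 ?mule0//.
  apply/seteqP; split=> // x /uB.
  by rewrite expr0 mulr1 => /andP[/le_lt_trans /[apply]]; rewrite ltxx.
pose w := (u * rho ^+ m)%R.
have w0 : (0 < w)%R by rewrite mulr_gt0// exprn_gt0.
have mlt : measurable (S `&` [set x | (dilation b x < w)%R] : set G).
  rewrite (_ : [set x | _] = dilation b @^-1` `]-oo, w[%classic).
    have mS := measurable_usphere.
    exact: (within_continuous_borel mS continuous_dilation mS (measurable_itv _)).
  by apply/seteqP; split=> x /=; rewrite in_itv.
pose B1 := B `&` [set x | (dilation b x < w)%R].
pose B2 := B `\` B1.
have mB1 : measurable (B1 : set G).
  rewrite (_ : B1 = B `&` (S `&` [set x | (dilation b x < w)%R])).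
    exact: measurableI.
  by have /setIidPl BSE := BS; rewrite setIA BSE.
have mB2 : measurable (B2 : set G) by exact: measurableD.
have BE : B = B1 `|` B2 by rewrite /B2 setDUK//; exact: subIsetl.
have B1S : B1 `<=` S by move=> x [/BS].
have B2S : B2 `<=` S by move=> x [/BS].
have dB : [disjoint B1 & B2] by rewrite disj_set2E setDIK.
rewrite [in leLHS]BE image_setU ge0_integral_setU//; last 4 first.
  by rewrite image_sphere_phi; exact: measurable_preimage_sphere_phi.
  by rewrite image_sphere_phi; exact: measurable_preimage_sphere_phi.
  exact: measurable_funTS.
  rewrite disj_set2E !image_sphere_phi -preimage_setI.
  by move: dB; rewrite disj_set2E => /eqP ->; rewrite preimage_set0.
rewrite [in leRHS]BE ge0_integral_setU//; last 2 first.
  rewrite -BE; apply: measurable_funS (measurable_dilation_phi d mf) => //.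
  exact: measurable_usphere.
  by rewrite -BE => x /BS; exact: dilation_phi_ge0.
rewrite ge0_muleDr; last 2 first.
  by apply: integral_ge0 => x /B1S; exact: dilation_phi_ge0.
  by apply: integral_ge0 => x /B2S; exact: dilation_phi_ge0.
apply: leeD.
  apply: IH => // x [/uB /andP[-> _]]; exact.
have B2w x : B2 x -> (w <= dilation b x)%R.
  by move=> [Bx nB1]; rewrite leNgt; apply/negP => xw; apply: nB1.
apply: (@le_trans _ _ (((w * rho) ^+ d)%:E * \int[mu d]_(x in B2) f (sphere_phi x))).
  apply: integral_sphere_phi_slab => //; first by rewrite mulr_gt0.
  by move=> x [/uB/andP[_]]; rewrite exprSr mulrA => /ltW.
rewrite mulrC exprMn EFinM -muleA; apply: lee_wpmul2l; first by rewrite lee_fin.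
have mfphi : measurable_fun (B2 : set G) (fun x : G => f (sphere_phi x)).
  apply: measurable_funTS; exact: (measurableT_comp mf measurable_sphere_phi).
rewrite -ge0_integralZl//; last by rewrite lee_fin exprn_ge0// ltW.
apply: ge0_le_integral => //.
- by move=> x _; rewrite mule_ge0// lee_fin exprn_ge0// ltW.
- exact: measurable_funeM.
- apply: measurable_funS (measurable_dilation_phi d mf) => //.
  exact: measurable_usphere.
- move=> x B2x; apply: lee_wpmul2r => //; rewrite lee_fin.
  by rewrite lerXn2r ?nnegrE ?(ltW w0)// ?B2w// (le_trans (ltW w0))// B2w.
Qed.

Lemma integral_sphere_phi_le d (B : set G) (f : G -> \bar R) :
  measurable B -> B `<=` S ->
  measurable_fun setT f -> (forall x, 0 <= f x) ->
  \int[mu d]_(x in sphere_phi @` B) f x <=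
  \int[mu d]_(x in B) ((dilation b x ^+ d)%:E * f (sphere_phi x)).
Proof.
move=> mB BS mf f0; have /andP[_ b1] := b01; have s0 := scoef_gt0 b1.
have H (rho : R) : (1 < rho)%R ->
    \int[mu d]_(x in sphere_phi @` B) f x <= (rho ^+ d)%:E *
    \int[mu d]_(x in B) ((dilation b x ^+ d)%:E * f (sphere_phi x)).
  move=> rho1; have rho0 : (0 < rho)%R by exact: lt_trans rho1.
  (* On the sphere 1 - b.y < 2, seen by applying the bound on x.b to -x; hence lam >= s/2. The upper
     bound 1/u follows since lam(x) is the inverse of lam(phi x). *)
  pose u := (scoef b / 2)%R; have u0 : (0 < u)%R by rewrite divr_gt0.
  have low x : S x -> (u <= dilation b x)%R.
    move=> Sx; apply: ler_wpM2l; [exact: ltW|rewrite lef_pV2 ?posrE//].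
      have SNx : S (- x)%R by rewrite /usphere/= enormN.
      have := usphere_dotp_lt1 b1 SNx.
      by rewrite -scaleN1r dotpZl mulN1r (dotpC b); lra.
    by rewrite subr_gt0 dotpC usphere_dotp_lt1.
  have up x : S x -> (dilation b x <= u^-1)%R.
    move=> Sx; have := dilation_phi b01 Sx.
    have Sy := phi_usphere b01 Sx; have := low _ Sy; have := dilation_gt0 b1 Sy.
    move=> y0 uy e; rewrite -[leLHS]mul1r -(mulVf (lt0r_neq0 u0)) -mulrA.
    rewrite ler_piMr ?invr_ge0 ?(ltW u0)// -e ler_wpM2r//.
    exact/ltW/dilation_gt0.
  have [m Hm] : exists m : nat, (u^-1 < u * rho ^+ m)%R.
    have /cvgrPdist_lt/(_ _ (exprn_gt0 2 u0)) : (GRing.exp rho^-1 : R^nat) @ \oo --> (0 : R)%R.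
      by apply: cvg_expr; rewrite ger0_norm ?invr_ge0 ?(ltW rho0)// invf_lt1.
    move=> [m _ /(_ m (leqnn m))] /=; rewrite sub0r normrN => /(le_lt_trans (ler_norm _)).
    rewrite exprVn => Hm; exists m; rewrite -div1r ltr_pdivrMr// mulrAC -expr2.
    by rewrite -ltr_pdivrMr ?exprn_gt0// div1r.
  apply: (@integral_sphere_phi_le_ratio d rho u m) => // x /BS Sx.
  by rewrite low//= (le_lt_trans (up _ Sx)).
apply: (lee_exp_gt1 (d := d)) => //.
by apply: integral_ge0 => x /BS; exact: dilation_phi_ge0.
Qed.

Lemma integral_sphere_phi d (B : set G) (f : G -> \bar R) :
  measurable B -> B `<=` S ->
  measurable_fun setT f -> (forall x, 0 <= f x) ->
  \int[mu d]_(x in sphere_phi @` B) f x =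
  \int[mu d]_(x in B) ((dilation b x ^+ d)%:E * f (sphere_phi x)).
Proof.
move=> mB BS mf f0; apply/eqP; rewrite eq_le integral_sphere_phi_le//=.
(* Cut off outside the sphere, where the dilation may be negative, to get a function nonnegative and
   measurable everywhere. *)
pose g := (fun x : G => (dilation b x ^+ d)%:E * f (sphere_phi x)) \_ S.
have mg : measurable_fun setT (g : G -> \bar R).
  by apply/(measurable_restrictT _ measurable_usphere); exact: measurable_dilation_phi.
have g0 x : 0 <= g x by apply: erestrict_ge0 => y; exact: dilation_phi_ge0.
have phiBS : sphere_phi @` B `<=` S by move=> _ [x /BS Sx <-]; exact: sphere_phi_usphere.
have mphiB : measurable (sphere_phi @` B : set G).
  by rewrite image_sphere_phi; exact: measurable_preimage_sphere_phi.
have := integral_sphere_phi_le d mphiB phiBS mg g0.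
rewrite sphere_phi_imageK.
congr (_ <= _); apply: eq_integral => x; rewrite inE => Dx.
  by rewrite /g patchE mem_set//; exact: BS.
have Sx := phiBS _ Dx; rewrite /g patchE mem_set; last exact: sphere_phi_usphere.
rewrite sphere_phiK sphere_phiE// muleA -EFinM -exprMn mulrC dilation_phi//.
by rewrite expr1n mul1e.
Qed.

End ChangeOfVariables.

(** * Back to integrals for the Caratheodory measure *)

Section Transfer.
Context {R : realType} {n : nat}.
Local Notation G := (g_sigma_algebraType (@open 'rV[R]_n.+1)).
Local Open Scope ereal_scope.

(** [h] is prescribed on the sphere only through [g], so that the positive and the negative parts of
    [f] and [Mtransform] both fit. *)
Lemma ge0_integral_phi (b : 'rV[R]_n.+1) d (A B : set 'rV[R]_n.+1)
    (g h : 'rV[R]_n.+1 -> \bar R) :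
  (0 < dotp b b < 1)%R ->
  measurable (A : set G) -> A `<=` usphere -> B = phi b @` A ->
  measurable_fun (usphere : set G) (g : G -> \bar R) ->
  (forall x, 0 <= g x) ->
  (forall y, usphere y -> h y = (dilation b y ^+ d)%:E * g (phi b y)) ->
  \int[hausdorff_measure d]_(x in A) g x =
  \int[hausdorff_measure d]_(x in B) h x.
Proof.
move=> b01 mA AS BE mg g0 hE; have /andP[_ b1] := b01.
pose G0 : G -> \bar R := g \_ usphere.
have mS : measurable (usphere : set G) by exact: measurable_usphere.
have mG0 : measurable_fun setT G0 by exact/(measurable_restrictT _ mS).
have G00 x : 0 <= G0 x by apply: erestrict_ge0.
have {}BE : B = sphere_phi b @` A.
  rewrite BE; apply/seteqP; split=> _ [x Ax <-]; exists x => //.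
    by rewrite sphere_phiE//; exact: AS.
  by rewrite sphere_phiE//; exact: AS.
have BS : B `<=` usphere.
  by rewrite BE => _ [x /AS Sx <-]; exact: sphere_phi_usphere.
have mB : measurable (B : set G).
  by rewrite BE image_sphere_phi//; exact: measurable_preimage_sphere_phi.
have BA : sphere_phi b @` B = A by rewrite BE sphere_phi_imageK.
transitivity (\int[hausdorff_measure d]_(x in A) G0 x).
  by apply: eq_integral => x /[!inE] /AS Sx; rewrite /G0 patchE mem_set.
rewrite ge0_integral_hausdorff_borel//; last exact: measurable_funTS.
(* The change of variables is applied with [B] as domain and [A] as its image. *)
rewrite -BA integral_sphere_phi// -ge0_integral_hausdorff_borel//.
- apply: eq_integral => x /[!inE] /BS Sx; rewrite hE// sphere_phiE// /G0 patchE.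
  by rewrite mem_set//; exact: phi_usphere.
- by apply: measurable_funS (measurable_dilation_phi b01 d mG0).
- by move=> x /BS; exact: dilation_phi_ge0.
Qed.

End Transfer.

Unset Implicit Arguments.

Theorem theorem5p1 (R : realType) (n k : nat) (a : 'rV[R]_n.+1)
    (f : 'rV[R]_n.+1 -> R) (t : set 'rV[R]_n.+1) :
  (2 <= n)%N -> (1 < k)%N -> (k <= n)%N ->
  1 < enorm a ->
  {within usphere, continuous f} ->
  planes_through k a t ->
  Ftransform k f t =
    Pitransform k (Mtransform k (star a) f) (phi_plane k a t).
Proof.
move=> _ _ _ a1 cf tT; rewrite /Ftransform /Pitransform /section_integral.
set b := star a; have b01 := enorm_star a1; have /andP[_ b1] := b01.
pose G := g_sigma_algebraType (@open 'rV[R]_n.+1).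
have mS : measurable (usphere : set G) by exact: measurable_usphere.
have mf : measurable_fun (usphere : set G) (EFin \o f : G -> \bar R).
  by apply/measurable_EFinP; exact: within_continuous_borel.
have mSt : measurable (usphere `&` t : set G).
  apply: measurableI => //; apply: closed_borel.
  by case: tT => -[p [V [_ ->]]] _; exact: closed_affine_plane.
have StS : usphere `&` t `<=` usphere by move=> x [].
have Sz := usphere_phi_plane a1 tT.
(* A signed integral is by definition the difference of those of the two parts, so equality of each
   part suffices, without integrability. *)
rewrite integralE [RHS]integralE; congr (_ - _)%E.
- apply: (ge0_integral_phi b01 mSt StS Sz).
  + exact: measurable_funepos.
  + by move=> x; exact: funepos_ge0.
  + move=> y Sy; rewrite !funeposE /Mtransform -/(dilation b y).
    (* The weight is nonnegative on the sphere and so commutes with taking the positive part. *)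
    rewrite maxe_pMr// ?mule0 -?EFinM// lee_fin exprn_ge0// ltW//.
    exact: dilation_gt0.
- apply: (ge0_integral_phi b01 mSt StS Sz).
  + exact: measurable_funeneg.
  + by move=> x; exact: funeneg_ge0.
  + move=> y Sy; rewrite !funenegE /Mtransform -/(dilation b y).
    rewrite maxe_pMr// ?mule0 ?muleN -?EFinM// lee_fin exprn_ge0// ltW//.
    exact: dilation_gt0.
Qed.
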